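(* Let $\Omega\subset\mathbb{R}^d$ be a nonempty compact convex set, let $m\ge1$, and let $f=\frac1m\sum_{i=1}^m f^i$, where each $f^i:\mathbb{R}^d\to\mathbb{R}$ is convex and $L$-smooth on $\mathbb{R}^d$. Let $Q=[[q_{ij}]]_{1\le i,j\le m}$ be a nonnegative weight matrix of a static undirected communication graph $\mathcal{G}=(\mathcal{V},\mathcal{E})$ on $\mathcal{V}=\{1,\dots,m\}$, i.e. $q_{ij}>0\iff(i,j)\in\mathcal{E}$, such that $Q$ is doubly stochastic ($\mathbf{1}^TQ=\mathbf{1}^T$ and $Q\mathbf{1}=\mathbf{1}$) and the graph is irreducible and aperiodic. Let $x^*\in\operatorname{argmin}_{x\in\Omega}f(x)$. Let $(x^i_k)_{k\ge0}$, $i=1,\dots,m$, be generated by the distributed dual averaging Frank-Wolfe algorithm (described in the context) with $\alpha_k=\frac{2}{k+1}$ and any parameters $\beta_k$ such that $\alpha_k=\frac{\beta_k}{\sum_{i=1}^k\beta_i}$ for all $k\ge1$. Let $\bar{x}_k:=\frac1m\sum_{i=1}^m x^i_k$. Then $$f(\bar{x}_k)-f(x^* )=\mathcal{O}\Big(\frac1k\Big),$$ i.e. there is a constant $C$ independent of $k$ such that $f(\bar x_k)-f(x^* )\le C/k$ for all $k\ge1$.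
   Context: $\|\cdot\|$ is the Euclidean norm and $\langle\cdot,\cdot\rangle$ the Euclidean inner product. A function $h$ is $L$-smooth if it is differentiable and $\|\nabla h(x)-\nabla h(y)\|\le L\|x-y\|$ for all $x,y\in\mathbb{R}^d$. Irreducible: there is a directed path from any node to any other node. Aperiodic: the g.c.d. of the lengths of all paths from a node to itself is one (self-loops $(i,i)$ are allowed). $\mathbf{1}$ is the all-ones vector in $\mathbb{R}^m$. Distributed dual averaging Frank-Wolfe algorithm. Input: real parameters $\alpha_k$, $\beta_k$, $k\ge1$ (with nonzero partial sums $\sum_{p=1}^k\beta_p$). Initialize $x^i_0\in\Omega$, $w^i_0\in\operatorname{argmin}_{x\in\Omega}\langle\nabla f^i(x^i_0),x\rangle$ and $g^i_0=0$ for all $i\in\{1,\dots,m\}$. For $k=1,2,\dots$, at each node $i$: 1. $z^i_{k-1}=(1-\alpha_k)x^i_{k-1}+\alpha_k w^i_{k-1}$. 2. Compute the gradient $\nabla f^i(z^i_{k-1})$. 3. $g^i_k=\frac{1}{\sum_{p=1}^k\beta_p}\sum_{j=1}^m q_{ij}\Big\{\big(\sum_{p=1}^{k-1}\beta_p\big)g^j_{k-1}+\beta_k\nabla f^j(z^j_{k-1})\Big\}$. 4. Choose $w^i_k\in\operatorname{argmin}_{w\in\Omega}\langle g^i_k,w\rangle$ (any minimizer). 5. $x^i_k=(1-\alpha_k)\sum_{j=1}^m q_{ij}x^j_{k-1}+\alpha_k w^i_k$. *)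

(* Defs.v *)
From HB Require Import structures.
From mathcomp Require Import all_boot all_order all_algebra.
From mathcomp Require Import all_classical all_reals all_analysis.

Set Implicit Arguments.
Unset Strict Implicit.
Unset Printing Implicit Defensive.

Import Order.TTheory GRing.Theory Num.Theory.
Import numFieldNormedType.Exports.

Local Open Scope classical_set_scope.
Local Open Scope ring_scope.

Definition dotv (R : realType) (d : nat) (u v : 'rV[R]_d) : R :=
  \sum_(j < d) u 0 j * v 0 j.

(* The library norm [`|u|] on ['rV[R]_d] is the sup norm, hence this separate
   Euclidean norm. Both induce the same topology and the same notion of
   differentiability, for which the library's [compact] and [differentiable]
   are used. *)
Definition enorm (R : realType) (d : nat) (u : 'rV[R]_d) : R :=
  Num.sqrt (dotv u u).

Definition grad (R : realType) (d : nat) (h : 'rV[R]_d -> R) (x : 'rV[R]_d) :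
    'rV[R]_d :=
  \row_(j < d) 'D_(delta_mx 0 j) h x.

Definition smooth (R : realType) (d : nat) (L : R) (h : 'rV[R]_d -> R) : Prop :=
  (forall x, differentiable h x) /\
  (forall x y, enorm (grad h x - grad h y) <= L * enorm (x - y)).

Definition argmin_on (R : realType) (T : Type) (A : set T) (h : T -> R) :
    set T :=
  [set x | A x /\ forall y, A y -> h x <= h y].

Definition doubly_stochastic (R : realType) (m : nat) (Q : 'M[R]_m) : Prop :=
  [/\ forall i j, 0 <= Q i j,
      const_mx 1 *m Q = const_mx 1 :> 'rV[R]_m
    & Q *m const_mx 1 = const_mx 1 :> 'cV[R]_m].

Definition irreducible_graph (m : nat) (e : rel 'I_m) : Prop :=
  forall i j, connect e i j.

Definition closed_path_length (m : nat) (e : rel 'I_m) (i : 'I_m) : set nat :=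
  [set n | exists p : seq 'I_m, [/\ path e i p, last i p = i & size p = n]].

Definition is_gcd (A : set nat) (g : nat) : Prop :=
  (forall n, A n -> (g %| n)%N) /\
  (forall c : nat, (forall n, A n -> (c %| n)%N) -> (c %| g)%N).

(* [closed_path_length] contains the trivial length 0, which does not affect
   the gcd. *)
Definition aperiodic_graph (m : nat) (e : rel 'I_m) : Prop :=
  forall i, is_gcd (closed_path_length e i) 1.

Definition psum (R : realType) (beta : nat -> R) (k : nat) : R :=
  \sum_(1 <= p < k.+1) beta p.

Definition mean_fun (R : realType) (d m : nat) (f : 'I_m -> 'rV[R]_d -> R)
    (y : 'rV[R]_d) : R :=
  m%:R^-1 * \sum_(i < m) f i y.

Definition mean_pt (R : realType) (d m : nat) (v : 'I_m -> 'rV[R]_d) :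
    'rV[R]_d :=
  m%:R^-1 *: \sum_(i < m) v i.

(* [x k i], [w k i], [z k i], [g k i] are the iterates at node [i] with time
   index [k]. Round [k.+1] computes [z k], [g k.+1], [w k.+1] and [x k.+1];
   [alpha 0] and [beta 0] are never used. The argmins need not be unique, so the
   algorithm is a relation on trajectories. *)
Record dda_frank_wolfe (R : realType) (d m : nat) (Omega : set 'rV[R]_d)
    (f : 'I_m -> 'rV[R]_d -> R) (Q : 'M[R]_m) (alpha beta : nat -> R)
    (x w z g : nat -> 'I_m -> 'rV[R]_d) : Prop := DdaFrankWolfe {
  dda_init_x : forall i, Omega (x 0%N i);
  dda_init_w : forall i,
    argmin_on Omega (fun y => dotv (grad (f i) (x 0%N i)) y) (w 0%N i);
  dda_init_g : forall i, g 0%N i = 0;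
  dda_step_z : forall k i,
    z k i = (1 - alpha k.+1) *: x k i + alpha k.+1 *: w k i;
  dda_step_g : forall k i,
    g k.+1 i = (psum beta k.+1)^-1 *:
      \sum_(j < m) Q i j *: (psum beta k *: g k j
                             + beta k.+1 *: grad (f j) (z k j));
  dda_step_w : forall k i,
    argmin_on Omega (fun y => dotv (g k.+1 i) y) (w k.+1 i);
  dda_step_x : forall k i,
    x k.+1 i = (1 - alpha k.+1) *: (\sum_(j < m) Q i j *: x k j)
               + alpha k.+1 *: w k.+1 i
}.

(* Main.v *)
(* With weights s_k = k (k + 1) / 2, so that alpha_k = k / s_k, the averaged
   iterate satisfies, up to an O(1) smoothness error,
     s_{k+1} f(xbar_{k+1}) <= s_k f(xbar_k) + (k + 1) l_{k+1}(wbar_{k+1}),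
   where l_{k+1} <= f is the average of the tangents at the points z^j_k. It
   remains to bound the regret of the w^i_k. That w^i_k only minimizes a local
   estimate s_k g^i_k which is O(k) away from its network average would cost
   O(k) per round. Instead the regret is charged to the increments of s_k g^i_k:
   w^i_k exactly minimizes their sum, so be-the-leader applies to them. They
   differ from the true averaged increments (k + 1) * mean_j grad f^j(z^j_k)
   only by O(1), because they obey the consensus recursion
     v_{k+1} = Q (v_k + (k + 1) G_k - k G_{k-1}),
   with G_k the gradients at z_k; its forcing term is bounded: consensus of the x^i_k gives
   |z_{k+1} - z_k| = O(1/k). Consensus errors are controlled by the contraction
   of the spread max_{i,j} |v i - v j| under a positive power of Q. *)
Require Import Defs.
From HB Require Import structures.
From mathcomp Require Import all_boot all_order all_algebra.
From mathcomp Require Import all_classical all_reals all_analysis.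
From mathcomp Require Import ring lra zify.

Set Implicit Arguments.
Unset Strict Implicit.
Unset Printing Implicit Defensive.

Import Order.TTheory GRing.Theory Num.Theory.
Import numFieldNormedType.Exports.

Local Open Scope classical_set_scope.
Local Open Scope ring_scope.

(** * Sup and Euclidean norms, gradients, convex functions *)

Section Euclidean.
Variables (R : realType) (d : nat).
Implicit Types (u v : 'rV[R]_d).

Lemma dotvC u v : dotv u v = dotv v u.
Proof. by apply: eq_bigr => j _; rewrite mulrC. Qed.

Lemma dotvDr u v1 v2 : dotv u (v1 + v2) = dotv u v1 + dotv u v2.
Proof. by rewrite -big_split; apply: eq_bigr => j _; rewrite mxE mulrDr. Qed.

Lemma dotvDl u1 u2 v : dotv (u1 + u2) v = dotv u1 v + dotv u2 v.
Proof. by rewrite dotvC dotvDr !(dotvC v). Qed.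

Lemma dotvZr c u v : dotv u (c *: v) = c * dotv u v.
Proof. by rewrite /dotv mulr_sumr; apply: eq_bigr => j _; rewrite mxE mulrCA. Qed.

Lemma dotvZl c u v : dotv (c *: u) v = c * dotv u v.
Proof. by rewrite dotvC dotvZr dotvC. Qed.

Lemma dotvBr u v1 v2 : dotv u (v1 - v2) = dotv u v1 - dotv u v2.
Proof. by rewrite dotvDr -scaleN1r dotvZr mulN1r. Qed.

Lemma dotvBl u1 u2 v : dotv (u1 - u2) v = dotv u1 v - dotv u2 v.
Proof. by rewrite dotvC dotvBr !(dotvC v). Qed.

Lemma dotv0l v : dotv 0 v = 0.
Proof. by rewrite -(scale0r 0) dotvZl mul0r. Qed.

Lemma dotv_suml (I : finType) (u : I -> 'rV[R]_d) v :
  dotv (\sum_i u i) v = \sum_i dotv (u i) v.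
Proof.
exact: (big_morph (fun u => dotv u v) (fun u1 u2 => dotvDl u1 u2 v) (dotv0l v)).
Qed.

Lemma dotv_sumr (I : finType) u (v : I -> 'rV[R]_d) :
  dotv u (\sum_i v i) = \sum_i dotv u (v i).
Proof. by rewrite dotvC dotv_suml; apply: eq_bigr => i _; rewrite dotvC. Qed.

Lemma coord_le_norm u j : `|u 0 j| <= `|u|.
Proof.
have -> : `|u| = \big[Num.max/0]_ij `|u ij.1 ij.2| by exact: mx_normrE.
exact: (le_bigmax _ (fun ij : 'I_1 * 'I_d => `|u ij.1 ij.2|) (0, j)).
Qed.

Lemma norm_le_coord u c : 0 <= c -> (forall j, `|u 0 j| <= c) -> `|u| <= c.
Proof.
move=> c0 uc; have -> : `|u| = \big[Num.max/0]_ij `|u ij.1 ij.2| by exact: mx_normrE.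
by apply: bigmax_le => // -[i j] _ /=; rewrite ord1.
Qed.

(** A Cauchy-Schwarz bound for the sup norm, in which all later estimates are made: each of the [d]
    terms is at most the product of the norms. *)
Lemma dotv_le u v : `|dotv u v| <= d%:R * (`|u| * `|v|).
Proof.
apply: (le_trans (ler_norm_sum _ _ _)).
rewrite -[d in d%:R]card_ord mulr_natl -sumr_const; apply: ler_sum => j _.
by rewrite normrM ler_pM ?coord_le_norm.
Qed.

Lemma enorm_ge0 u : 0 <= enorm u.
Proof. exact: sqrtr_ge0. Qed.

Lemma norm_le_enorm u : `|u| <= enorm u.
Proof.
apply: norm_le_coord (enorm_ge0 u) _ => j.
rewrite -sqrtr_sqr ler_sqrt; last by apply: sumr_ge0 => i _; exact: sqr_ge0.
rewrite /dotv (bigD1 j) //= expr2 lerDl.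
by apply: sumr_ge0 => i _; exact: sqr_ge0.
Qed.

Lemma enorm_le_norm u : enorm u <= Num.sqrt d%:R * `|u|.
Proof.
have -> : Num.sqrt d%:R * `|u| = Num.sqrt (d%:R * `|u| ^+ 2).
  by rewrite sqrtrM ?ler0n // sqrtr_sqr normr_id.
rewrite ler_sqrt; last by rewrite mulr_ge0 ?ler0n ?sqr_ge0.
by apply: le_trans (dotv_le u u); exact: ler_norm.
Qed.

Lemma derive_grad (h : 'rV[R]_d -> R) x v :
  differentiable h x -> 'D_v h x = dotv (grad h x) v.
Proof.
move=> dh; rewrite deriveE // {1}(row_sum_delta v) linear_sum.
apply: eq_bigr => j _.
by rewrite linearZ /= mxE deriveE // mulrC.
Qed.

(** By convexity the difference quotient of [h] at [x] towards [y] is at most [h y - h x] for every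
    step in (0, 1]; the bound passes to the limit from the right. *)
Lemma convex_ge_tangent (h : 'rV[R]_d -> R) x y :
  convex_function [set: 'rV[R]_d] h -> differentiable h x ->
  h x + dotv (grad h x) (y - x) <= h y.
Proof.
move=> hc dh; rewrite -lerBrDl -derive_grad //.
have /cvg_ex [l hl] := @diff_derivable _ _ _ h x (y - x) dh.
have -> : 'D_(y - x) h x = l by apply: cvg_lim hl.
have {}hl := cvg_dnbhs_at_right hl.
apply: (cvgr_to_le hl); near=> t.
have t0 : 0 < t by near: t; exact: nbhs_right_gt.
have t1 : t <= 1 by near: t; apply: nbhs_right_le.
have := hc (Itv01 (ltW t0) t1) y x (mem_setT _) (mem_setT _).
rewrite convRE /= => hxy.
have -> : t *: (y - x) + x = t *: y + (1 - t) *: x.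
  by rewrite scalerBr scalerBl scale1r addrA addrAC.
rewrite /= ler_pdivrMl //; apply: (le_trans (lerB hxy (lexx _))).
by rewrite /unstable.onem; lra.
Unshelve. all: by end_near. Qed.

(* Applying the tangent inequality at [y] avoids integrating the gradient and
   only costs a factor 2. *)
Lemma convex_smooth_upper (h : 'rV[R]_d -> R) K x y :
  convex_function [set: 'rV[R]_d] h -> (forall x, differentiable h x) ->
  (forall x y, `|grad h x - grad h y| <= K * `|x - y|) ->
  h y <= h x + dotv (grad h x) (y - x) + d%:R * K * `|y - x| ^+ 2.
Proof.
move=> hc dh hK.
have := convex_ge_tangent x hc (dh y).
have := dotv_le (grad h y - grad h x) (y - x).
have := ler_wpM2l (ler0n R d) (ler_wpM2r (normr_ge0 (y - x)) (hK y x)).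
have := ler_norm (dotv (grad h y - grad h x) (y - x)).
rewrite !dotvBl !dotvBr expr2 !mulrA; lra.
Qed.

(** [L] may be negative, hence the absolute value; the root of [d] converts the Euclidean norm back
    to the sup norm. *)
Lemma smooth_grad_lipschitz (L : R) (h : 'rV[R]_d -> R) : smooth L h ->
  forall x y, `|grad h x - grad h y| <= (`|L| * Num.sqrt d%:R) * `|x - y|.
Proof.
move=> [_ hL] x y; apply: (le_trans (norm_le_enorm _)).
apply: (le_trans (hL x y)); rewrite -mulrA.
apply: (@le_trans _ _ (`|L| * enorm (x - y))).
  by rewrite ler_wpM2r ?enorm_ge0 ?ler_norm.
by rewrite ler_wpM2l // enorm_le_norm.
Qed.

End Euclidean.

(** * Walks in the communication graph *)

Definition walk (T : finType) (e : rel T) (i j : T) (n : nat) : Prop :=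
  exists p : seq T, [/\ path e i p, last i p = j & size p = n].

Section Walks.
Variables (T : finType) (e : rel T).

Lemma walk_cat i j k n1 n2 :
  walk e i j n1 -> walk e j k n2 -> walk e i k (n1 + n2)%N.
Proof.
move=> [p [ep <- <-]] [q [eq <- <-]]; exists (p ++ q).
by rewrite cat_path ep eq last_cat size_cat.
Qed.

Lemma walk_closed_double i n a : walk e i i n -> walk e i i (a * n)%N.
Proof.
by move=> ein; elim: a => [|a IH]; [exists [::]|rewrite mulSn; apply: walk_cat IH].
Qed.

End Walks.

(** Otherwise 2 would divide the gcd: [walk e i i] unfolds to [closed_path_length e i]. *)
Lemma aperiodic_odd_walk m (e : rel 'I_m) i : aperiodic_graph e ->
  exists2 n, odd n & walk e i i n.
Proof.
move=> /(_ i) [_ /(_ 2%N) h]; apply: contrapT => no_odd.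
suff : (2 %| 1)%N by [].
apply: h => n wn; rewrite dvdn2; apply/negP => on.
by apply: no_odd; exists n.
Qed.

(* Symmetry provides closed walks of length 2, so one odd closed walk already
   yields closed walks of every large enough length. *)
Lemma closed_walk_eventually m (e : rel 'I_m) i : symmetric e ->
  aperiodic_graph e -> exists N, forall n, (N <= n)%N -> walk e i i n.
Proof.
move=> esym eap; have [n0 on0 wn0] := aperiodic_odd_walk i eap.
have w2 : walk e i i 2.
  (* An odd walk is not empty; its first edge, traversed back and forth, has length 2. *)
  case: wn0 => -[|j p]; first by case=> _ _ s0; move: on0; rewrite -s0.
  by case=> /= /andP[eij _] _ _; exists [:: j; i]; rewrite /= eij esym eij.
exists n0 => n n0n; have [on|en] := boolP (odd n).
  have -> : n = (n0 + (n - n0)./2 * 2)%N by lia.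
  exact: walk_cat wn0 (walk_closed_double _ w2).
have -> : n = (n./2 * 2)%N by lia.
exact: walk_closed_double.
Qed.

(** Precede a fixed path from [i] to [j] by a closed walk at [i] of the right length; finitely many
    pairs allow a common length. *)
Lemma walk_eventually m (e : rel 'I_m) : symmetric e ->
  irreducible_graph e -> aperiodic_graph e ->
  exists2 N, (0 < N)%N & forall i j, walk e i j N.
Proof.
move=> esym eirr eap.
have /choice [N hN] : forall ij : 'I_m * 'I_m,
    exists N, forall n, (N <= n)%N -> walk e ij.1 ij.2 n.
  move=> [i j] /=; have [N hN] := closed_walk_eventually i esym eap.
  have /connectP [p ep jE] := eirr i j.
  exists (N + size p)%N => n hn; have -> : n = (n - size p + size p)%N by lia.
  by apply: (walk_cat (hN _ _)); [lia|exists p].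
exists (\max_ij N ij).+1 => // i j.
exact: (hN (i, j)) (leqW (leq_bigmax (F := N) (i, j))).
Qed.

(** * Stochastic matrices and contraction of the spread *)

Section Mixing.
Variables (R : realType) (m : nat).

Definition row_stochastic (P : 'M[R]_m) : Prop :=
  (forall i j, 0 <= P i j) /\ (forall i, \sum_j P i j = 1).

Lemma row_stochasticM P P' :
  row_stochastic P -> row_stochastic P' -> row_stochastic (P *m P').
Proof.
move=> [P0 P1] [P'0 P'1]; split=> [i j|i].
  by rewrite mxE sumr_ge0 // => k _; rewrite mulr_ge0.
under eq_bigr do rewrite mxE.
rewrite exchange_big /= -[RHS](P1 i).
by apply: eq_bigr => k _; rewrite -mulr_sumr P'1 mulr1.
Qed.

Lemma row_stochastic1 : row_stochastic 1%:M.
Proof.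
split=> [i j|i]; first by rewrite mxE ler0n.
rewrite (bigD1 i) //= mxE eqxx big1 ?addr0 // => j ji.
by rewrite mxE eq_sym (negbTE ji).
Qed.

Lemma row_stochasticX P n : row_stochastic P -> row_stochastic (P ^+ n).
Proof.
move=> Ps; elim: n => [|n IH]; first exact: row_stochastic1.
by rewrite exprS; apply: row_stochasticM.
Qed.

Lemma exp_gt0_walk (e : rel 'I_m) (Q : 'M[R]_m) i j n :
  (forall i j, 0 <= Q i j) -> (forall i j, e i j -> 0 < Q i j) ->
  walk e i j n -> 0 < (Q ^+ n) i j.
Proof.
move=> Q0 Qe; elim: n i => [|n IH] i [p [ep pj sp]].
  by move: pj; rewrite (size0nil sp) /= => ->; rewrite expr0 mxE eqxx.
case: p ep pj sp => //= k p /andP[eik ep] pj [sp].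
have Qn0 a b : 0 <= (Q ^+ n) a b.
  elim: n {IH sp} a b => [|n IH] a b; first by rewrite mxE ler0n.
  by rewrite exprS mxE sumr_ge0 // => l _; rewrite mulr_ge0.
rewrite exprS mxE (bigD1 k) //= ltr_pwDl //.
  by rewrite mulr_gt0 ?Qe ?IH //; exists p.
by rewrite sumr_ge0 // => l _; rewrite mulr_ge0.
Qed.

Variable V : normedModType R.
Implicit Types (v u : 'I_m -> V) (P Q : 'M[R]_m).

Definition mix P v (i : 'I_m) : V := \sum_j P i j *: v j.

Definition spread_le v (c : R) : Prop := forall i j, `|v i - v j| <= c.

Lemma mixD P v u : mix P (fun i => v i + u i) = (fun i => mix P v i + mix P u i).
Proof.
by apply/funext => i; rewrite /mix -big_split; apply: eq_bigr => j _; rewrite scalerDr.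
Qed.

Lemma mixM P P' v : mix (P *m P') v = mix P (mix P' v).
Proof.
apply/funext => i; rewrite /mix.
under eq_bigr do rewrite mxE scaler_suml.
rewrite exchange_big /=; apply: eq_bigr => k _; rewrite scaler_sumr.
by apply: eq_bigr => j _; rewrite scalerA.
Qed.

Lemma mix1 v : mix 1%:M v = v.
Proof.
apply/funext => i; rewrite /mix (bigD1 i) //= mxE eqxx scale1r big1 ?addr0 // => j ji.
by rewrite mxE eq_sym (negbTE ji) scale0r.
Qed.

Lemma mix_cst P (a : V) i : row_stochastic P -> mix P (fun=> a) i = a.
Proof. by move=> [_ P1]; rewrite /mix -scaler_suml P1 scale1r. Qed.

Lemma norm_mix_le P v c i : row_stochastic P ->
  (forall j, `|v j| <= c) -> `|mix P v i| <= c.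
Proof.
move=> [P0 P1] vc; apply: (le_trans (ler_norm_sum _ _ _)).
rewrite -[c]mul1r -(P1 i) mulr_suml; apply: ler_sum => j _.
by rewrite normrZ ger0_norm // ler_wpM2l.
Qed.

Lemma spread_leD v u a b : spread_le v a -> spread_le u b ->
  spread_le (fun i => v i + u i) (a + b).
Proof.
move=> va ub i j; rewrite opprD addrACA.
by apply: (le_trans (ler_normD _ _)); rewrite lerD.
Qed.

Lemma norm_spread_le v c : (forall i, `|v i| <= c) -> spread_le v (2 * c).
Proof.
by move=> vc i j; apply: (le_trans (ler_normB _ _)); rewrite mulr2n mulrDl mul1r lerD.
Qed.

(* Coupling the rows [i] and [j] independently: the diagonal of the coupling
   contributes nothing. *)
Lemma spread_mix P v c i j : row_stochastic P -> spread_le v c ->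
  `|mix P v i - mix P v j| <= (1 - \sum_l P i l * P j l) * c.
Proof.
move=> [P0 P1] vc.
have c0 : 0 <= c by apply: le_trans (vc i i).
have -> : mix P v i - mix P v j = \sum_k \sum_l (P i k * P j l) *: (v k - v l).
  transitivity (\sum_k \sum_l (P i k * P j l) *: v k -
                \sum_k \sum_l (P i k * P j l) *: v l).
    congr (_ - _); last rewrite exchange_big /=; apply: eq_bigr => k _.
      by rewrite -scaler_suml -mulr_sumr P1 mulr1.
    by rewrite -scaler_suml -mulr_suml P1 mul1r.
  rewrite -sumrB; apply: eq_bigr => k _; rewrite -sumrB.
  by apply: eq_bigr => l _; rewrite scalerBr.
apply: (le_trans (ler_norm_sum _ _ _)).
rewrite mulrBl mul1r mulr_suml -[X in X - _]mul1r -(P1 i) mulr_suml -sumrB.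
apply: ler_sum => k _; apply: (le_trans (ler_norm_sum _ _ _)).
rewrite (bigD1 k) //= subrr scaler0 normr0 add0r.
have -> : P i k * c - P i k * P j k * c = \sum_(l | l != k) P i k * P j l * c.
  rewrite -mulr_suml -mulr_sumr -mulrBl; congr (_ * _).
  by rewrite -[X in X - _]mulr1 -(P1 j) (bigD1 k) //= mulrDr addrAC subrr add0r.
 apply: ler_sum => l _.
by rewrite normrZ ger0_norm ?mulr_ge0 // ler_wpM2l ?mulr_ge0.
Qed.

Lemma spread_mix_le P v c : row_stochastic P -> spread_le v c ->
  spread_le (mix P v) c.
Proof.
move=> Ps vc i j; have c0 : 0 <= c by apply: le_trans (vc i i).
apply: (le_trans (spread_mix i j Ps vc)).
rewrite ler_piMl // gerBl sumr_ge0 // => l _.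
by case: Ps => P0 _; rewrite mulr_ge0.
Qed.

(** The overlap of rows [i] and [j] in [spread_mix] is at least its term [l = i], hence at least
    [D ^+ 2]. *)
Lemma spread_mix_contract P v c (D : R) : row_stochastic P ->
  (forall i j, D <= P i j) -> 0 <= D -> spread_le v c ->
  spread_le (mix P v) ((1 - D ^+ 2) * c).
Proof.
move=> Ps PD D0 vc i j; have c0 : 0 <= c by apply: le_trans (vc i i).
apply: (le_trans (spread_mix i j Ps vc)); rewrite ler_wpM2r // lerB //.
rewrite (bigD1 i) //= expr2; apply: ler_wpDr; last by rewrite ler_pM.
by apply: sumr_ge0 => l _; case: Ps => P0 _; rewrite mulr_ge0.
Qed.


Lemma spread_iter Q (v u : nat -> 'I_m -> V) (c : R) n k K :
  row_stochastic Q ->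
  (forall k, v k.+1 = fun i => mix Q (v k) i + u k i) ->
  (forall k, (k < K)%N -> spread_le (u k) c) -> (k + n <= K)%N ->
  exists2 r, v (k + n)%N = (fun i => mix (Q ^+ n) (v k) i + r i) &
    spread_le r (n%:R * c).
Proof.
move=> Qs vS uc; elim: n => [|n IH] knK.
  exists (fun=> 0); last by move=> i j; rewrite subrr normr0 mul0r.
  by rewrite addn0 expr0 mix1; apply/funext => i; rewrite addr0.
have [|r vr rc] := IH; first by lia.
exists (fun i => mix Q r i + u (k + n)%N i).
  rewrite addnS vS vr mixD exprS mixM; apply/funext => i; exact: esym (addrA _ _ _).
rewrite -natr1 mulrDl mul1r; apply: spread_leD; first exact: spread_mix_le.
by apply: uc; lia.
Qed.

(** Over [N] rounds a spread S becomes at most (1 - D^2) S + N c, which preserves every bound that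
    is at least N c / D^2; the extra [N] covers the first rounds. The forcing is bounded only before
    time [K], so [c] may grow with [K]. *)
Lemma spread_bounded (Q : 'M[R]_m) N : (0 < N)%N -> row_stochastic Q ->
  (forall i j, 0 < (Q ^+ N) i j) ->
  exists2 C : R, 0 <= C & forall (v u : nat -> 'I_m -> V) (c : R) K,
    0 <= c -> (forall i, v 0%N i = 0) ->
    (forall k, v k.+1 = fun i => mix Q (v k) i + u k i) ->
    (forall k, (k < K)%N -> spread_le (u k) c) ->
    spread_le (v K) (C * c).
Proof.
move=> N0 Qs QN.
have [D D0 QD] : exists2 D : R, 0 < D & forall i j, D <= (Q ^+ N) i j.
  exists (\big[Order.min/1]_(ij : 'I_m * 'I_m) (Q ^+ N) ij.1 ij.2).
    by apply: lt_bigmin => // -[i j] _; exact: QN.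
  by move=> i j; exact: (bigmin_le _ (i, j)).
have D2 : 0 < D ^+ 2 by rewrite exprn_gt0.
exists (N%:R + N%:R / D ^+ 2); first by rewrite addr_ge0 // divr_ge0 // ltW.
move=> v u c K c0 v0 vS uc.
suff H k : (k <= K)%N -> spread_le (v k) ((N%:R + N%:R / D ^+ 2) * c) by exact: H.
elim/ltn_ind: k => k IH kK.
have ND0 : 0 <= N%:R / D ^+ 2 * c by rewrite mulr_ge0 // divr_ge0 // ltW.
have [kN|Nk] := leqP k N.
  have [|r vr rc] := @spread_iter Q v u c k 0 K Qs vS uc; first by rewrite add0n.
  move=> i j; rewrite -[k]add0n vr.
  have -> : mix (Q ^+ k) (v 0%N) = fun=> 0.
    by apply/funext => l; rewrite /mix big1 // => ? _; rewrite v0 scaler0.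
  rewrite !add0r; apply: (le_trans (rc i j)).
  rewrite mulrDl ler_wpDr // ler_wpM2r // ler_nat; lia.
have [|r vr rc] := @spread_iter Q v u c N (k - N) K Qs vS uc; first by lia.
have kNk : (k - N < k)%N by lia.
have {}IH := IH _ kNk (leq_trans (ltnW kNk) kK).
have {IH} := spread_leD (spread_mix_contract (row_stochasticX N Qs) QD (ltW D0) IH) rc.
rewrite -vr subnK ?(ltnW Nk) // => h i j; apply: (le_trans (h i j)).
(* What the contraction removes over one block pays for the forcing of that block. *)
have DC : N%:R * c <= D ^+ 2 * ((N%:R + N%:R / D ^+ 2) * c).
  rewrite mulrA mulrDr [_ * (_ / _)]mulrCA divff ?gt_eqF // mulr1 ler_wpM2r //.
  by rewrite lerDr mulr_ge0 // ltW.
lra.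
Qed.

End Mixing.

(** * Network averages *)

Section Averages.
Variables (R : realType) (d m : nat).
Implicit Types (v : 'I_m -> 'rV[R]_d) (Q : 'M[R]_m).

(** Averaging is mixing by the uniform matrix, so the bounds for [mix] also serve [mean_pt]. *)
Lemma mean_pt_mix v i : mean_pt v = mix (const_mx m%:R^-1) v i.
Proof.
by rewrite /mean_pt /mix scaler_sumr; apply: eq_bigr => j _; rewrite mxE.
Qed.

Lemma row_stochastic_uniform :
  (0 < m)%N -> row_stochastic (const_mx m%:R^-1 : 'M[R]_m).
Proof.
move=> m0; split=> [i j|i]; first by rewrite mxE invr_ge0.
under eq_bigr do rewrite mxE.
by rewrite sumr_const card_ord -[LHS]mulr_natr mulVf // pnatr_eq0 -lt0n.
Qed.

Lemma norm_mix_sub_le Q v c i :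
  row_stochastic Q -> spread_le v c -> `|mix Q v i - v i| <= c.
Proof.
move=> Qs vc; have -> : mix Q v i - v i = mix Q (fun j => v j - v i) i.
  by rewrite mixD mix_cst.
exact: norm_mix_le.
Qed.

Lemma norm_mean_sub_le v c i : spread_le v c -> `|mean_pt v - v i| <= c.
Proof.
rewrite (mean_pt_mix v i); apply: norm_mix_sub_le; apply: row_stochastic_uniform.
exact: leq_ltn_trans (ltn_ord i).
Qed.

Lemma norm_mean_le v c : (0 < m)%N -> (forall i, `|v i| <= c) ->
  `|mean_pt v| <= c.
Proof.
move=> m0; rewrite (mean_pt_mix v (Ordinal m0)).
exact/norm_mix_le/row_stochastic_uniform.
Qed.

(** Unit column sums conserve the total, which lets the averages evolve without [Q]. *)
Lemma sum_mix Q v : (forall j, \sum_i Q i j = 1) ->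
  \sum_i mix Q v i = \sum_i v i.
Proof.
move=> Q1; rewrite exchange_big; apply: eq_bigr => j _.
by rewrite -scaler_suml Q1 scale1r.
Qed.

Lemma sum_ord_const (a : R) : \sum_(i < m) a = m%:R * a.
Proof. by rewrite sumr_const card_ord mulr_natl. Qed.

End Averages.

(** * Iterates of the algorithm under uniform bounds *)

Section DualAveraging.
Variables (R : realType) (d m : nat) (Omega : set 'rV[R]_d).
Variables (f : 'I_m -> 'rV[R]_d -> R) (Q : 'M[R]_m) (alpha beta : nat -> R).
Variables (x w z g : nat -> 'I_m -> 'rV[R]_d) (K M G C : R).
Hypothesis m_gt0 : (0 < m)%N.
Hypothesis f_convex : forall i, convex_function [set: 'rV[R]_d] (f i).
Hypothesis f_diff : forall i y, differentiable (f i) y.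
Hypothesis K_ge0 : 0 <= K.
Hypothesis f_lip : forall i y y',
  `|grad (f i) y - grad (f i) y'| <= K * `|y - y'|.
Hypothesis Q_row : row_stochastic Q.
Hypothesis Q_col : forall j, \sum_i Q i j = 1.
Hypothesis Omega_le : forall y, Omega y -> `|y| <= M.
Hypothesis G_ge : forall i y, `|y| <= M -> `|grad (f i) y| <= G.
Hypothesis C_ge0 : 0 <= C.
Hypothesis Q_mixing : forall (v u : nat -> 'I_m -> 'rV[R]_d) (c : R) k,
    0 <= c -> (forall i, v 0%N i = 0) ->
    (forall k, v k.+1 = fun i => mix Q (v k) i + u k i) ->
    (forall l, (l < k)%N -> spread_le (u l) c) ->
    spread_le (v k) (C * c).
Hypothesis psum_neq0 : forall k : nat, (1 <= k)%N -> psum beta k != 0.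
Hypothesis alphaE : forall k : nat, (1 <= k)%N -> alpha k = 2 / k.+1%:R.
Hypothesis alpha_beta :
  forall k : nat, (1 <= k)%N -> alpha k = beta k / psum beta k.
Hypothesis algo : dda_frank_wolfe Omega f Q alpha beta x w z g.

Definition weight (k : nat) : R := k%:R * k.+1%:R / 2.

Lemma weight0 : weight 0 = 0.
Proof. by rewrite /weight !mul0r. Qed.

Lemma weightS k : weight k.+1 = weight k + k.+1%:R.
Proof. by rewrite /weight -!natr1; field. Qed.

Lemma weight_gt0 k : (0 < k)%N -> 0 < weight k.
Proof. by move=> k0; rewrite /weight divr_gt0 // mulr_gt0 // ltr0n. Qed.

Lemma weight_ge0 k : 0 <= weight k.
Proof. by rewrite /weight divr_ge0 // mulr_ge0. Qed.

Lemma weight_alpha k : weight k.+1 * alpha k.+1 = k.+1%:R.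
Proof.
rewrite alphaE // /weight.
by field; rewrite -natrD pnatr_eq0.
Qed.

Lemma weight_onem_alpha k : weight k.+1 * (1 - alpha k.+1) = weight k.
Proof. by rewrite mulrBr mulr1 weight_alpha weightS addrK. Qed.

Lemma alpha_ge0 k : 0 <= alpha k.+1.
Proof. by rewrite alphaE // divr_ge0. Qed.

Lemma alpha_le1 k : alpha k.+1 <= 1.
Proof. by rewrite alphaE // ler_pdivrMr ?ltr0n // mul1r ler_nat. Qed.

Lemma alpha_le k : alpha k.+1 <= 2 / k.+1%:R.
Proof. by rewrite alphaE // ler_pM2l // lef_pV2 ?posrE ?ltr0n // ler_nat. Qed.

(** Together with [alpha_beta] this eliminates [beta]: up to a nonzero factor of either sign,
    [psum beta] is [weight]. *)
Lemma psum_ratio k : (psum beta k.+1)^-1 * psum beta k = 1 - alpha k.+1.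
Proof.
have p0 := psum_neq0 (ltn0Sn k).
rewrite alpha_beta //; apply: (mulfI p0).
rewrite mulrA divff // mul1r mulrBr mulr1 mulrCA divff // mulr1.
by rewrite [psum beta k.+1]big_nat_recr //= addrK.
Qed.

Lemma Omega_w k i : Omega (w k i).
Proof.
by case: k => [|k]; [case: (dda_init_w algo i)|case: (dda_step_w algo k i)].
Qed.

Lemma norm_w_le k i : `|w k i| <= M.
Proof. exact/Omega_le/Omega_w. Qed.

Lemma M_ge0 : 0 <= M.
Proof. exact: le_trans (normr_ge0 _) (norm_w_le 0 (Ordinal m_gt0)). Qed.

(** Balls are convex, so the bound on [Omega] passes to [x] and [z]. *)
Lemma norm_conv_le k (u v : 'rV[R]_d) c : `|u| <= c -> `|v| <= c ->
  `|(1 - alpha k.+1) *: u + alpha k.+1 *: v| <= c.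
Proof.
move=> uc vc; have a0 := alpha_ge0 k; have a1 := alpha_le1 k.
apply: (le_trans (ler_normD _ _)); rewrite !normrZ !ger0_norm ?subr_ge0 //.
have -> : c = (1 - alpha k.+1) * c + alpha k.+1 * c by ring.
by rewrite lerD // ler_wpM2l // subr_ge0.
Qed.

Lemma norm_x_le k i : `|x k i| <= M.
Proof.
elim: k i => [|k IH] i; first exact/Omega_le/(dda_init_x algo).
by rewrite (dda_step_x algo) norm_conv_le ?norm_w_le // norm_mix_le.
Qed.

Lemma norm_z_le k i : `|z k i| <= M.
Proof. by rewrite (dda_step_z algo) norm_conv_le ?norm_w_le ?norm_x_le. Qed.

Definition node_grad k j : 'rV[R]_d := grad (f j) (z k j).

Lemma norm_node_grad_le k j : `|node_grad k j| <= G.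
Proof. exact/G_ge/norm_z_le. Qed.

Lemma G_ge0 : 0 <= G.
Proof. exact: le_trans (normr_ge0 _) (norm_node_grad_le 0 (Ordinal m_gt0)). Qed.

(** * Consensus of [x] and slow drift of [z] *)

Let c1 : R := 4 * C * M + 2 * M.

Lemma c1_ge0 : 0 <= c1.
Proof. by have := mulr_ge0 C_ge0 M_ge0; have := M_ge0; rewrite /c1; lra. Qed.

Lemma weighted_xS k i :
  weight k.+1 *: x k.+1 i
  = mix Q (fun j => weight k *: x k j) i + k.+1%:R *: w k.+1 i.
Proof.
rewrite (dda_step_x algo) scalerDr !scalerA weight_alpha weight_onem_alpha.
by congr (_ + _); rewrite scaler_sumr; apply: eq_bigr => j _; rewrite !scalerA mulrC.
Qed.

(** [weight k *: x k] follows the consensus recursion with forcing O(k), so its spread is linear in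
    [k] while [weight] is quadratic. In [c1], [4 * C * M] comes from this division and [2 * M]
    covers [k = 0], where [weight] vanishes. *)
Lemma spread_x k : spread_le (x k) (c1 / k.+1%:R).
Proof.
have M0 := M_ge0; have CM := mulr_ge0 C_ge0 M0.
case: k => [|k] i j.
  rewrite divr1; apply: (le_trans (norm_spread_le (norm_x_le 0) i j)).
  by rewrite /c1; lra.
have w0 : 0 < weight k.+1 by exact: weight_gt0.
rewrite -(ler_pM2l w0) -[weight k.+1 as X in X * `|_|]gtr0_norm //.
rewrite -normrZ scalerBr.
have := @Q_mixing (fun k i => weight k *: x k i) (fun k i => k.+1%:R *: w k.+1 i)
   (2 * (k.+1%:R * M)) k.+1 _ _ _ _ i j.
move=> h; apply: (le_trans (h _ _ _ _)).
- by rewrite !mulr_ge0.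
- by move=> l; rewrite weight0 scale0r.
- by move=> l; apply/funext => a; exact: weighted_xS.
- move=> l lk; apply: norm_spread_le => a.
  by rewrite normrZ ger0_norm // ler_pM // ?ler_nat ?norm_w_le.
have -> : weight k.+1 * (c1 / k.+2%:R) = k.+1%:R * c1 / 2.
  by rewrite /weight; field; rewrite -natrD pnatr_eq0.
have := mulr_ge0 (ler0n R k.+1) M0; rewrite /c1; lra.
Qed.

Lemma norm_zx_le k i : `|z k i - x k i| <= 4 * M / k.+1%:R.
Proof.
have -> : z k i - x k i = alpha k.+1 *: (w k i - x k i).
  by rewrite (dda_step_z algo); apply/rowP => j; rewrite !mxE; ring.
rewrite normrZ ger0_norm ?alpha_ge0 //.
have -> : 4 * M / k.+1%:R = 2 / k.+1%:R * (M + M) by ring.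
rewrite ler_pM ?alpha_ge0 ?alpha_le //.
by apply: (le_trans (ler_normB _ _)); rewrite lerD ?norm_w_le ?norm_x_le.
Qed.

Lemma norm_xx_le k i : `|x k.+1 i - x k i| <= (c1 + 4 * M) / k.+1%:R.
Proof.
have -> : x k.+1 i - x k i = (mix Q (x k) i - x k i)
    + alpha k.+1 *: (w k.+1 i - mix Q (x k) i).
  rewrite (dda_step_x algo) -/(mix Q (x k) i).
  by apply/rowP => j; rewrite !mxE; ring.
apply: (le_trans (ler_normD _ _)); rewrite mulrDl lerD //.
  exact: norm_mix_sub_le (spread_x k).
rewrite normrZ ger0_norm ?alpha_ge0 //.
have -> : 4 * M / k.+1%:R = 2 / k.+1%:R * (M + M) by ring.
rewrite ler_pM ?alpha_ge0 ?alpha_le //.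
apply: (le_trans (ler_normB _ _)); rewrite lerD ?norm_w_le //.
by apply: norm_mix_le => // j; exact: norm_x_le.
Qed.

(** The move of [x] costs [c1 + 4 * M]; the gaps between [z] and [x] at both ends cost [4 * M]
    each. *)
Let c2 : R := c1 + 12 * M.

Lemma norm_zz_le k i : `|z k.+1 i - z k i| <= c2 / k.+1%:R.
Proof.
have -> : z k.+1 i - z k i = (z k.+1 i - x k.+1 i) + (x k.+1 i - x k i)
    - (z k i - x k i).
  by rewrite addrA subrK opprB addrA subrK.
apply: (le_trans (ler_normB _ _)).
have := ler_normD (z k.+1 i - x k.+1 i) (x k.+1 i - x k i).
have := norm_zx_le k.+1 i; have := norm_zx_le k i; have := norm_xx_le k i.
have : 4 * M / k.+2%:R <= 4 * M / k.+1%:R.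
  by rewrite ler_wpM2l ?mulr_ge0 ?M_ge0 // lef_pV2 ?posrE ?ltr0n // ler_nat.
rewrite /c2; move: (k.+1%:R^-1) (k.+2%:R^-1) => q q2; lra.
Qed.

(** The difference is the gradient at [z k] plus [k] times a gradient change that is O(1/k) by the
    drift of [z]. At [k = 0] the zero factor absorbs the convention for [k.-1]. *)
Lemma weighted_grad_diff_le k j :
  `|k.+1%:R *: node_grad k j - k%:R *: node_grad k.-1 j| <= G + K * c2.
Proof.
have c20 : 0 <= c2 by have := c1_ge0; have := M_ge0; rewrite /c2; lra.
case: k => [|k] /=.
  by rewrite scale0r subr0 scale1r ler_wpDr ?norm_node_grad_le // mulr_ge0.
rewrite -natr1 scalerDl scale1r addrAC -scalerBr addrC.
apply: (le_trans (ler_normD _ _)); rewrite lerD ?norm_node_grad_le //.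
rewrite normrZ ger0_norm // mulrC -ler_pdivlMr ?ltr0n //.
apply: (le_trans (f_lip _ _ _)); rewrite -mulrA ler_wpM2l //; exact: norm_zz_le.
Qed.

(** * Dual variables and their increments *)

Definition dual k i : 'rV[R]_d := weight k *: g k i.

Lemma dual0 i : dual 0 i = 0.
Proof. by rewrite /dual weight0 scale0r. Qed.

(** Scaling by [weight] turns the averages [g] into running sums: the coefficients [1 - alpha] and
    [alpha] become [weight k] and [k.+1]. *)
Lemma dualS k : dual k.+1 = mix Q (fun j => dual k j + k.+1%:R *: node_grad k j).
Proof.
apply/funext => i; rewrite /dual (dda_step_g algo) !scaler_sumr.
apply: eq_bigr => j _.
have -> : weight k.+1 *: ((psum beta k.+1)^-1 *: (Q i j *: (psum beta k *: g k j +
    beta k.+1 *: grad (f j) (z k j)))) = Q i j *: (weight k.+1 *: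
     (((psum beta k.+1)^-1 * psum beta k) *: g k j +
      (beta k.+1 / psum beta k.+1) *: grad (f j) (z k j))).
  rewrite !scalerDr !scalerA; congr (_ *: _ + _ *: _); ring.
rewrite psum_ratio -alpha_beta // !scalerDr !(scalerA (weight k.+1)).
by rewrite weight_onem_alpha weight_alpha.
Qed.

(** As [0.-1] is [0], the increment at time 0 vanishes, which is the zero start that [Q_mixing] asks
    for. *)
Definition dual_step k i : 'rV[R]_d := dual k i - dual k.-1 i.

Let c4 : R := C * (2 * (G + K * c2)).

(** [dualS] is linear, so subtracting consecutive instances gives a consensus recursion for the
    increments, with forcing controlled by [weighted_grad_diff_le]. *)
Lemma spread_dual_step k : spread_le (dual_step k) c4.
Proof.
have c20 : 0 <= c2 by have := c1_ge0; have := M_ge0; rewrite /c2; lra.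
pose u k := mix Q (fun j => k.+1%:R *: node_grad k j - k%:R *: node_grad k.-1 j).
apply: (@Q_mixing dual_step u).
- by rewrite mulr_ge0 // addr_ge0 ?G_ge0 // mulr_ge0.
- by move=> i; rewrite /dual_step subrr.
- case=> [|l]; apply/funext => i; rewrite /dual_step /u /=.
    rewrite dualS dual0 subr0 -[RHS](congr1 (fun h => h i) (mixD _ _ _)).
    by congr (mix Q _ i); apply/funext => j; rewrite dual0 subrr scale0r subr0.
  rewrite 2!dualS -[RHS](congr1 (fun h => h i) (mixD _ _ _)) /mix -sumrB.
  apply: eq_bigr => j _; rewrite -scalerBr; congr (_ *: _).
  by rewrite opprD addrACA.
- move=> l _; apply: spread_mix_le => //; apply: norm_spread_le => j.
  exact: weighted_grad_diff_le.
Qed.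

Lemma mean_dual_step k :
  mean_pt (dual_step k.+1) = (k.+1%:R / m%:R) *: \sum_j node_grad k j.
Proof.
rewrite /mean_pt /dual_step /= sumrB dualS sum_mix // big_split /= addrAC subrr add0r.
by rewrite -scaler_sumr scalerA mulrC.
Qed.

Lemma dual_step_near_mean k i :
  `|dual_step k.+1 i - (k.+1%:R / m%:R) *: \sum_j node_grad k j| <= c4.
Proof.
by rewrite -mean_dual_step distrC norm_mean_sub_le //; exact: spread_dual_step.
Qed.

(** * Descent of the averaged iterate *)

Let c5 : R := c1 + 4 * M.

Lemma weighted_mean_xS k :
  weight k.+1 *: mean_pt (x k.+1)
  = weight k *: mean_pt (x k) + k.+1%:R *: mean_pt (w k.+1).
Proof.
have sC a (u : 'rV[R]_d) : a *: (m%:R^-1 *: u) = m%:R^-1 *: (a *: u).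
  by rewrite !scalerA mulrC.
rewrite /mean_pt !sC -scalerDr; congr (_ *: _).
rewrite !scaler_sumr; under eq_bigr do rewrite weighted_xS.
by rewrite big_split /= sum_mix.
Qed.

Lemma mean_xS k : mean_pt (x k.+1)
  = (1 - alpha k.+1) *: mean_pt (x k) + alpha k.+1 *: mean_pt (w k.+1).
Proof.
have w0 : weight k.+1 != 0 by rewrite gt_eqF // weight_gt0.
apply: (scalerI w0); rewrite weighted_mean_xS scalerDr !scalerA.
by rewrite weight_alpha weight_onem_alpha.
Qed.

(** Both points are convex combinations with the same coefficients; the spread of [x k] bounds one
    difference and the step size the other. *)
Lemma norm_mean_xz_le k j : `|mean_pt (x k.+1) - z k j| <= c5 / k.+1%:R.
Proof.
have -> : mean_pt (x k.+1) - z k j = (1 - alpha k.+1) *: (mean_pt (x k) - x k j)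
    + alpha k.+1 *: (mean_pt (w k.+1) - w k j).
  by rewrite mean_xS (dda_step_z algo) !scalerBr opprD addrACA.
have a0 := alpha_ge0 k; have a1 := alpha_le1 k.
apply: (le_trans (ler_normD _ _)); rewrite !normrZ !ger0_norm ?subr_ge0 //.
have -> : c5 / k.+1%:R = c1 / k.+1%:R + 4 * M / k.+1%:R by rewrite -mulrDl.
rewrite lerD //.
  apply: le_trans (norm_mean_sub_le j (spread_x k)).
  by rewrite ler_piMl // gerBl.
have -> : 4 * M / k.+1%:R = 2 / k.+1%:R * (M + M) by ring.
rewrite ler_pM ?alpha_le //.
apply: (le_trans (ler_normB _ _)); rewrite lerD ?norm_w_le // norm_mean_le //.
by move=> i; exact: norm_w_le.
Qed.

Let c6 : R := d%:R * K * c5 ^+ 2.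

(** Everything is linearized at [z k j]: smoothness bounds [f j] from above at the new average,
    tangents bound it from below at the old average and at [y]. The linear terms match through
    [weighted_mean_xS]. *)
Lemma descent k j y :
  weight k.+1 * f j (mean_pt (x k.+1)) <= weight k * f j (mean_pt (x k))
  + k.+1%:R * (f j y + dotv (node_grad k j) (mean_pt (w k.+1) - y)) + c6.
Proof.
have c50 : 0 <= c5 by have := c1_ge0; have := M_ge0; rewrite /c5; lra.
have hX' := convex_smooth_upper (z k j) (mean_pt (x k.+1)) (f_convex j)
   (f_diff j) (f_lip j).
have hX := convex_ge_tangent (mean_pt (x k)) (f_convex j) (f_diff j (z k j)).
have hy := convex_ge_tangent y (f_convex j) (f_diff j (z k j)).
(* The squared O(1/k) distance offsets the quadratic weight; the factor left over, (k + 2) / (2 (k +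
   1)), is at most 1. *)
have rest : weight k.+1 * (d%:R * K * `|mean_pt (x k.+1) - z k j| ^+ 2) <= c6.
  rewrite mulrCA /c6 ler_wpM2l ?mulr_ge0 //.
  have r2 : `|mean_pt (x k.+1) - z k j| ^+ 2 <= (c5 / k.+1%:R) ^+ 2.
    by rewrite lerXn2r ?nnegrE ?divr_ge0 // norm_mean_xz_le.
  apply: (le_trans (ler_wpM2l (weight_ge0 k.+1) r2)).
  have -> : weight k.+1 * (c5 / k.+1%:R) ^+ 2 = k.+2%:R / (2 * k.+1%:R) * c5 ^+ 2.
    by rewrite /weight; field; rewrite nat1r pnatr_eq0.
  rewrite ler_piMl ?sqr_ge0 // ler_pdivrMr ?mulr_gt0 ?ltr0n // mul1r -natrM ler_nat.
  lia.
have := ler_wpM2l (weight_ge0 k.+1) hX'.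
have := ler_wpM2l (weight_ge0 k) hX.
have := ler_wpM2l (ler0n R k.+1) hy.
have : weight k.+1 * dotv (node_grad k j) (mean_pt (x k.+1))
    = weight k * dotv (node_grad k j) (mean_pt (x k))
      + k.+1%:R * dotv (node_grad k j) (mean_pt (w k.+1)).
  by rewrite -dotvZr weighted_mean_xS dotvDr (dotvZr (weight k)) (dotvZr k.+1%:R).
rewrite -/(node_grad k j) !dotvBr weightS in rest *.
lra.
Qed.

(** * Regret bound and rate *)

Lemma dual_argmin k i y : Omega y -> dotv (dual k i) (w k i) <= dotv (dual k i) y.
Proof.
move=> Oy; case: k => [|k]; first by rewrite dual0 !dotv0l.
rewrite /dual !dotvZl ler_wpM2l ?weight_ge0 //.
by have [_] := dda_step_w algo k i; apply.
Qed.

Let c7 : R := m%:R * (c6 + d%:R * (c4 * (M + M))).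

(** The dual sum, nonpositive by [dual_argmin], is what lets the induction close with a constant
    loss [c7] per round. *)
Lemma potential_le k y : Omega y ->
  weight k * \sum_j (f j (mean_pt (x k)) - f j y)
  <= \sum_i dotv (dual k i) (w k i - y) + c7 * k%:R.
Proof.
move=> Oy; elim: k => [|k IH].
  by rewrite weight0 mul0r mulr0 addr0 big1 // => i _; rewrite dual0 dotv0l.
have step : weight k.+1 * \sum_j (f j (mean_pt (x k.+1)) - f j y)
   <= weight k * (\sum_j (f j (mean_pt (x k)) - f j y))
    + k.+1%:R * dotv (\sum_j node_grad k j) (mean_pt (w k.+1) - y) + m%:R * c6.
  rewrite dotv_suml !mulr_sumr -sum_ord_const -!big_split /=; apply: ler_sum => j _.
  by have := descent k j y; rewrite weightS; lra.
(* Splitting the averaged [w] over the nodes puts each [w k.+1 i] against the common gradient, which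
   is then exchanged for the node's own [dual_step]. *)
have gradE : k.+1%:R * dotv (\sum_j node_grad k j) (mean_pt (w k.+1) - y)
    = \sum_i dotv ((k.+1%:R / m%:R) *: \sum_j node_grad k j) (w k.+1 i - y).
  rewrite -dotv_sumr dotvZl sumrB sumr_const card_ord -[y *+ m]scaler_nat /mean_pt.
  have m0 : m%:R != 0 :> R by rewrite pnatr_eq0 -lt0n.
  by rewrite !dotvBr !dotvZr; field.
have bound : \sum_i dotv ((k.+1%:R / m%:R) *: \sum_j node_grad k j) (w k.+1 i - y)
    <= \sum_i dotv (dual_step k.+1 i) (w k.+1 i - y)
      + m%:R * (d%:R * (c4 * (M + M))).
  rewrite -sum_ord_const -big_split /=.
  apply: ler_sum => i _; rewrite -lerBlDl -dotvBl.
  apply: (le_trans (ler_norm _)); apply: (le_trans (dotv_le _ _)).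
  rewrite ler_wpM2l // ler_pM //; first by rewrite distrC dual_step_near_mean.
  by apply: (le_trans (ler_normB _ _)); rewrite lerD ?norm_w_le ?Omega_le.
(* Be-the-leader: replacing [w k.+1 i] by the minimizer [w k i] of [dual k i] only lowers the
   value. *)
have dual_sum_le : \sum_i dotv (dual k i) (w k i - y)
    + \sum_i dotv (dual_step k.+1 i) (w k.+1 i - y)
    <= \sum_i dotv (dual k.+1 i) (w k.+1 i - y).
  rewrite -big_split; apply: ler_sum => i _ /=.
  by have := dual_argmin k i (Omega_w k.+1 i); rewrite /dual_step dotvBl !dotvBr /=; lra.
move: IH step bound dual_sum_le; rewrite gradE -natr1 /c7; lra.
Qed.

Lemma mean_gap_le k y : (0 < k)%N -> Omega y ->
  mean_fun f (mean_pt (x k)) - mean_fun f y <= (2 * (m%:R^-1 * c7)) / k%:R.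
Proof.
move=> k0 Oy; have k0' : 0 < k%:R :> R by rewrite ltr0n.
have pot := potential_le k Oy.
have neg : \sum_i dotv (dual k i) (w k i - y) <= 0.
  by rewrite sumr_le0 // => i _; rewrite dotvBr subr_le0 dual_argmin.
rewrite /mean_fun -mulrBr -sumrB.
set S := \sum_j _ in pot *.
have SC : k.+1%:R / 2 * S <= c7.
  have : weight k * S <= c7 * k%:R by lra.
  by rewrite /weight [c7 * _]mulrC -!mulrA ler_pM2l // !mulrA.
have S_le : S <= 2 * c7 / k.+1%:R by rewrite ler_pdivlMr ?ltr0n //; lra.
(* This sign permits weakening 1 / (k + 1) to 1 / k. *)
have c70 : 0 <= c7.
  have c20 : 0 <= c2 by have := c1_ge0; have := M_ge0; rewrite /c2; lra.
  have c40 : 0 <= c4 by rewrite mulr_ge0 // mulr_ge0 // addr_ge0 ?G_ge0 // mulr_ge0.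
  have MM := addr_ge0 M_ge0 M_ge0.
  have c60 : 0 <= c6 by rewrite mulr_ge0 ?exprn_even_ge0 // mulr_ge0.
  apply: mulr_ge0 => //; apply: addr_ge0 => //.
  by apply: mulr_ge0 => //; apply: mulr_ge0.
have -> : 2 * (m%:R^-1 * c7) / k%:R = m%:R^-1 * (2 * c7 / k%:R) by ring.
rewrite ler_wpM2l ?invr_ge0 //.
apply: (le_trans S_le); rewrite ler_wpM2l //; first exact: mulr_ge0.
by rewrite lef_pV2 ?posrE ?ltr0n // ler_nat.
Qed.

End DualAveraging.

(** * Choice of the constants and conclusion *)

Theorem theorem4 (R : realType) (d m : nat) (Omega : set 'rV[R]_d)
    (f : 'I_m -> 'rV[R]_d -> R) (L : R)
    (e : rel 'I_m) (Q : 'M[R]_m) (alpha beta : nat -> R)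
    (x w z g : nat -> 'I_m -> 'rV[R]_d) (xstar : 'rV[R]_d)
    (m_ge1 : (1 <= m)%N)
    (Omega_nonempty : Omega !=set0)
    (Omega_compact : compact Omega)
    (Omega_convex : convex_set Omega)
    (f_convex : forall i, convex_function [set: 'rV[R]_d] (f i))
    (f_smooth : forall i, smooth L (f i))
    (e_sym : symmetric e)
    (Q_weight : forall i j, 0 < Q i j <-> e i j)
    (Q_ds : doubly_stochastic Q)
    (e_irr : irreducible_graph e)
    (e_aper : aperiodic_graph e)
    (xstar_min : argmin_on Omega (mean_fun f) xstar)
    (beta_neq0 : forall k : nat, (1 <= k)%N -> psum beta k != 0)
    (alphaE : forall k : nat, (1 <= k)%N -> alpha k = 2 / k.+1%:R)
    (alpha_beta : forall k : nat, (1 <= k)%N -> alpha k = beta k / psum beta k)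
    (algo : dda_frank_wolfe Omega f Q alpha beta x w z g) :
  exists C : R, forall k : nat, (1 <= k)%N ->
    mean_fun f (mean_pt (x k)) - mean_fun f xstar <= C / k%:R.
Proof.
have [L_lip f_diff] : (forall i y y', `|grad (f i) y - grad (f i) y'|
    <= (`|L| * Num.sqrt d%:R) * `|y - y'|) /\ forall i y, differentiable (f i) y.
  by split=> i; [exact: smooth_grad_lipschitz|case: (f_smooth i)].
have [Q0 Qcol Qrow] := Q_ds.
have Q_row : row_stochastic Q.
  split=> // i; have /matrixP /(_ i 0) := Qrow; rewrite !mxE => <-.
  by apply: eq_bigr => j _; rewrite mxE mulr1.
have Q_col j : \sum_i Q i j = 1.
  have /matrixP /(_ 0 j) := Qcol; rewrite !mxE => <-.
  by apply: eq_bigr => i _; rewrite mxE mul1r.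
have [M [_ M_gt]] := compact_bounded Omega_compact.
(* [compact_bounded] gives every number strictly above [M] as a bound, so [M + 1] is taken. *)
have Omega_le y : Omega y -> `|y| <= M + 1 by apply: M_gt; rewrite ltrDl.
have [N N0 walkN] := walk_eventually e_sym e_irr e_aper.
have QN i j : 0 < (Q ^+ N) i j.
  by apply: (exp_gt0_walk Q0 _ (walkN i j)) => a b /Q_weight.
have [C C0 Q_mixing] := @spread_bounded R m 'rV[R]_d Q N N0 Q_row QN.
pose K := `|L| * Num.sqrt d%:R; have K0 : 0 <= K by rewrite mulr_ge0 ?sqrtr_ge0.
(* Gradient at the origin plus Lipschitz growth over the ball; the sum over nodes dominates each
   single term. *)
pose G := \sum_i `|grad (f i) 0| + K * (M + 1).
have G_ge i y : `|y| <= M + 1 -> `|grad (f i) y| <= G.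
  move=> yM; rewrite -[grad _ y](subrK (grad (f i) 0)) addrC.
  apply: (le_trans (ler_normD _ _)); rewrite lerD //.
    by rewrite (bigD1 i) //= lerDl sumr_ge0.
  by apply: (le_trans (L_lip _ _ _)); rewrite subr0 ler_wpM2l.
(* The constant is read off from [mean_gap_le] and involves only data fixed before [k]. *)
eexists => k k1.
apply: (@mean_gap_le R d m Omega f Q alpha beta x w z g K (M + 1) G C) => //.
by case: xstar_min.
Qed.
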